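(* Let $b\ge 2$ be an integer and let $(h_k)_{k\ge0}$ be the sequence of integers defined by $h_0=1$ and $h_{k+1}=b^{k+1}h_k+1$ for $k\ge0$. Then for every positive integer $q$ there exist infinitely many $k\in\mathbb{N}$ such that $h_{k+1}\equiv 1 \pmod q$. *)

(* Defs.v *)
From mathcomp Require Import all_boot all_order all_algebra.

Set Implicit Arguments.
Unset Strict Implicit.
Unset Printing Implicit Defensive.

Import GRing.Theory.
Local Open Scope ring_scope.

Fixpoint hseq (b : int) (k : nat) : int :=
  if k is k'.+1 then b ^+ k'.+1 * hseq b k' + 1 else 1.

(* Main.v *)
Require Import Defs.
From mathcomp Require Import all_boot all_order all_algebra.
From mathcomp Require Import classical_sets cardinality.
From mathcomp Require Import cyclic ring.

Set Implicit Arguments.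
Unset Strict Implicit.
Unset Printing Implicit Defensive.

Import Order.TTheory GRing.Theory Num.Theory.
Local Open Scope classical_set_scope.
Local Open Scope ring_scope.

(** Since [hseq b k.+1 - 1 = b ^+ k.+1 * hseq b k], the claim is that [q]
    divides this product for infinitely many [k].  Split [q = r * m], where the
    primes of [r] divide [b] and [m] is coprime to [b].  The factor [r] divides
    [b ^+ k.+1] as soon as [k] is large ([dvdn_expn_pi_part]), so it remains to
    make [m] divide [hseq b k].

    The recurrence can be run one step backwards, with the value [0] at index
    [-1].  Modulo [m] its coefficients [b ^+ k] are periodic and invertible, so
    one expects the value [0] to recur.  To see this concretely, write [g n] for
    the term of index [n - 1], so that [g 0 = 0] and [g n.+1 = b ^+ n * g n + 1].
    If [b ^+ D = 1] modulo [m], the sequence restarted at [D] obeys the same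
    affine recurrence as [g], and the difference of the two is [g D] times the
    product of the coefficients:
    [g (D + n) = g n + b ^+ 'C(n, 2) * g D] modulo [m] ([hshift_addn]).
    For [D] twice the totient of [m] and [n] a multiple of [D], the exponent
    ['C(n, 2)] is a multiple of the totient, hence [g (D * t) = t * g D]
    modulo [m] ([hshift_mulnD]), which vanishes whenever [m] divides [t]. *)

(** The sequence with its index shifted by one, so that it can start from the
    value [0]. *)
Definition hshift (b : int) (n : nat) : int :=
  if n is k.+1 then hseq b k else 0.

Lemma hshiftS b n : hshift b n.+1 = b ^+ n * hshift b n + 1.
Proof. by case: n => [|n] //=; rewrite mulr0 add0r. Qed.

(** Both [n |-> g (D + n)] and [g] satisfy the recurrence modulo [m], so their
    difference is multiplied by [b ^+ n] at step [n]; these factors accumulate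
    to [b ^+ (0 + 1 + ... + (n - 1))]. *)
Lemma hshift_addn (b m : int) (D n : nat) : (m %| b ^+ D - 1)%Z ->
  (m %| hshift b (D + n) - (hshift b n + b ^+ 'C(n, 2) * hshift b D))%Z.
Proof.
move=> mD; elim: n => [|n IHn]; first by rewrite addn0 mul1r add0r subrr dvdz0.
rewrite addnS !hshiftS binS bin1 !exprD.
set x := hshift b (D + n) in IHn *; set y := hshift b D in IHn *.
have -> : b ^+ D * b ^+ n * x + 1
      - (b ^+ n * hshift b n + 1 + b ^+ 'C(n, 2) * b ^+ n * y) =
    b ^+ n * (x - (hshift b n + b ^+ 'C(n, 2) * y))
    + b ^+ n * x * (b ^+ D - 1) by ring.
by rewrite rpredD // dvdz_mull.
Qed.

Lemma dvdz_expr_subr1 (b m : int) (d n : nat) :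
  (m %| b ^+ d - 1)%Z -> (d %| n)%N -> (m %| b ^+ n - 1)%Z.
Proof.
by move=> md /dvdnP[k ->]; rewrite mulnC exprM subrX1 dvdz_mulr.
Qed.

(** The period is doubled because ['C(e * t, 2)] need not be a multiple of [e],
    whereas ['C(e.*2 * t, 2) = e * t * (e.*2 * t - 1)] is. *)
Lemma hshift_mulnD (b m : int) (e t : nat) : (m %| b ^+ e - 1)%Z ->
  (m %| hshift b (e.*2 * t) - t%:R * hshift b e.*2)%Z.
Proof.
move=> me; elim: t => [|t IHt]; first by rewrite muln0 mul0r subrr dvdz0.
have m2e : (m %| b ^+ e.*2 - 1)%Z.
  by apply: dvdz_expr_subr1 me _; rewrite -muln2 dvdn_mulr.
have mC : (m %| b ^+ 'C(e.*2 * t, 2) - 1)%Z.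
  apply: dvdz_expr_subr1 me _.
  by rewrite bin2 -doubleMl -doubleMl doubleK -mulnA dvdn_mulr.
rewrite mulnS -natr1; move: (hshift_addn (e.*2 * t) m2e).
set x := hshift b (_ + _); set y := hshift b (_ * t) in IHt *.
set z := hshift b _ in IHt *; move=> mx.
have -> : x - (t%:R + 1) * z = (x - (y + b ^+ 'C(e.*2 * t, 2) * z))
    + (y - t%:R * z) + z * (b ^+ 'C(e.*2 * t, 2) - 1) by ring.
by apply: rpredD; [apply: rpredD | rewrite dvdz_mull].
Qed.

(** No prime occurs in [n] with an exponent larger than [n]. *)
Lemma dvdn_expn_pi_part (b n : nat) : (0 < b)%N -> (0 < n)%N ->
  (n`_\pi(b) %| b ^ n)%N.
Proof.
move=> b_gt0 n_gt0; apply/dvdn_partP => [|p]; first exact: part_gt0.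
rewrite pi_of_part // inE /= => /andP[_ pb].
have [p_pr _ p_b]: [/\ prime p, (0 < b)%N & (p %| b)%N].
  by move: pb; rewrite mem_primes => /and3P.
rewrite p_part; apply: (@dvdn_trans (p ^ n)); last exact: dvdn_exp2r.
apply: dvdn_exp2l; apply: leq_trans (ltnW (ltn_logl p n_gt0)).
by apply: dvdn_leq_log => //; apply: dvdn_part.
Qed.

Lemma unbounded_infinite_nat (A : set nat) :
  (forall N, exists2 n, (N < n)%N & A n) -> infinite_set A.
Proof.
move=> unbA /finite_seqP[s As].
have [n lt_s_n] := unbA (\max_(i <- s) i)%N.
rewrite As /= => s_n; move: lt_s_n; rewrite ltnNge => /negP; apply.
exact: (@leq_bigmax_seq _ s xpredT id).
Qed.

Theorem proposition2p4 (b : int) (hb : 2 <= b) (q : int) (hq : 0 < q) :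
  infinite_set [set k : nat | (hseq b k.+1 = 1 %[mod q])%Z].
Proof.
apply: unbounded_infinite_nat => N.
case: b hb => [b|] // hb; case: q hq => [q|] // q_gt0.
have b_gt0 : (0 < b)%N by apply: ltnW.
have {}q_gt0 : (0 < q)%N by [].
set m := (q`_\pi(b)^')%N; set e := totient m.
have m_gt0 : (0 < m)%N by apply: part_gt0.
have e_gt0 : (0 < e)%N by rewrite totient_gt0.
have co_bm : coprime b m.
  by rewrite (@pnat_coprime \pi(b)) ?pnat_pi ?part_pnat.
have bX k : b%:Z ^+ k = (b ^ k)%N.
  by rewrite -[b%:Z]natz -natrX natz.
have me : (m%:Z %| b%:Z ^+ e - 1)%Z.
  have := Euler_exp_totient co_bm => /eqP bm.
  by rewrite -eqz_mod_dvd bX !modz_nat.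
(* The factor m makes t = m * (N + q).+2 vanish modulo m; the other factor puts
   the index n.-1 beyond N, and beyond q so that b ^+ n absorbs the part of q
   supported on the primes of b. *)
pose n := (e.*2 * (m * (N + q).+2))%N.
have n_gt : (N + q < n.-1)%N.
  rewrite -ltnS prednK; last by rewrite !muln_gt0 double_gt0 e_gt0 m_gt0.
  by rewrite /n mulnA leq_pmull // muln_gt0 double_gt0 e_gt0.
exists n.-1; first exact: leq_ltn_trans (leq_addr _ _) n_gt.
have mn : (m%:Z %| hseq b n.-1)%Z.
  have -> : hseq b n.-1 = hshift b n by case: (n) n_gt.
  have := hshift_mulnD (m * (N + q).+2) me.
  rewrite -/n rpredBr // dvdz_mulr //.
  by rewrite natz dvdzE dvdn_mulr.
apply/eqP; rewrite eqz_mod_dvd /= addrK -[q](partnC \pi(b)) // PoszM.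
rewrite dvdz_mul // bX.
apply: dvdn_trans (dvdn_expn_pi_part b_gt0 q_gt0) _.
apply: dvdn_exp2l; apply: leqW; apply: leq_trans (ltnW n_gt).
exact: leq_addl.
Qed.
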